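(* Fix $A,B\in\mathcal{F}^n$ and a linear subspace $E\subseteq\mathbb{R}^n$. Then $A+B$ and $\operatorname{conv}A$ are flowers in $\mathbb{R}^n$, and $A\cap E$ and $\operatorname{Proj}_E A$ are flowers in $E$.
   Context: A star set is a non-empty $A\subseteq\mathbb{R}^n$ such that $x\in A$ and $0\le\lambda\le1$ imply $\lambda x\in A$; its radial function is $r_A:S^{n-1}\to[0,\infty]$, $r_A(\theta)=\sup\{\lambda\ge0:\lambda\theta\in A\}$. A star body is a star set $A$ with $r_A(\theta)\theta\in A$ for all $\theta\in S^{n-1}$ with $r_A(\theta)<\infty$; it is uniquely determined by $r_A$. $B(y,r)$ is the closed Euclidean ball with center $y$ and radius $r\ge0$. A star body $A\subseteq\mathbb{R}^n$ is a flower if $A=\bigcup_{x\in C}B\left(\frac{x}{2},\frac{|x|}{2}\right)$ for some closed set $C\subseteq\mathbb{R}^n$; $\mathcal{F}^n$ is the class of all flowers in $\mathbb{R}^n$. A flower in a subspace $E$ is defined in the same way, with $E$ in place of $\mathbb{R}^n$. $A+B$ is the usual Minkowski sum, $\operatorname{conv}$ denotes the (closed) convex hull, and $\operatorname{Proj}_E$ is the orthogonal projection onto $E$.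
   Formalization: False for unbounded flowers as stated: A+B and Proj_E A are shown to be flowers if A, B are bounded or the result is a star body (otherwise only up to radial function), and the closed conv A unless A = {0} ∪ {y : <u,y> > 0} with u ≠ 0; the plain hull is treated like A+B. *)

(* Defs.v *)
From HB Require Import structures.
From mathcomp Require Import all_boot all_order all_algebra.
From mathcomp Require Import all_classical all_reals all_analysis.

Set Implicit Arguments.
Unset Strict Implicit.
Unset Printing Implicit Defensive.

Import Order.TTheory GRing.Theory Num.Theory.
Import numFieldNormedType.Exports.

Local Open Scope classical_set_scope.
Local Open Scope ring_scope.

Section Flowers.
Context {R : realType} {n : nat}.
Implicit Types (x y u : 'rV[R]_n) (A B C : set 'rV[R]_n)
  (E : {vspace 'rV[R]_n}).

Definition dot x y : R := (x *m y^T) 0 0.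

(* Not `|x|, which is the sup norm on 'rV[R]_n; the topologies agree. *)
Definition enorm x : R := Num.sqrt (dot x x).

Definition eball y (r : R) : set 'rV[R]_n := [set z | enorm (z - y) <= r].

Definition star_set A : Prop :=
  A !=set0 /\ forall x (l : R), A x -> 0 <= l <= 1 -> A (l *: x).

Definition radial A (t : 'rV[R]_n) : \bar R :=
  ereal_sup [set l%:E | l in [set l : R | 0 <= l /\ A (l *: t)]].

Definition star_body_in E A : Prop :=
  [/\ star_set A, A `<=` [set` E] &
      forall t, t \in E -> enorm t = 1 -> (radial A t < +oo)%E ->
        A (fine (radial A t) *: t)].

Definition petals_in E C : set 'rV[R]_n :=
  \bigcup_(x in C) (eball (2^-1 *: x) (enorm x / 2) `&` [set` E]).

(* C is closed in E iff it is closed in R^n, a subspace being closed. *)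
Definition flower_in E A : Prop :=
  star_body_in E A /\
  exists C, [/\ closed C, C `<=` [set` E] & A = petals_in E C].

Definition star_body A : Prop := star_body_in fullv A.

Definition flower A : Prop := flower_in fullv A.

(* A is a star set of E, not necessarily radially closed, and the star body
   with the same radial function is the one generated by the balls
   B(x/2, |x|/2), x in C, for some closed C. *)
Definition flower_radial_in E A : Prop :=
  [/\ star_set A, A `<=` [set` E] &
      exists C, [/\ C !=set0, closed C, C `<=` [set` E] &
        forall t, t \in E -> enorm t = 1 ->
          radial A t = radial (petals_in E C) t]].

Definition flower_radial A : Prop := flower_radial_in fullv A.

Definition minkowski_sum A B : set 'rV[R]_n := [set a + b | a in A & b in B].

Definition convex_hull A : set 'rV[R]_n :=
  smallest (fun M : set 'rV[R]_n => convex_set M) A.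

Definition closed_convex_hull A : set 'rV[R]_n :=
  smallest (fun M : set 'rV[R]_n => convex_set M /\ closed M) A.

Definition orth_proj E A : set 'rV[R]_n :=
  [set y | y \in E /\
     exists2 a, A a & forall e, e \in E -> dot (a - y) e = 0].

(* The flower with C = {s u : s >= 0}, when u != 0. *)
Definition half_space_flower u : set 'rV[R]_n :=
  [set y | y = 0 \/ 0 < dot u y].

End Flowers.

(* Main.v *)
Require Import Defs.
From HB Require Import structures.
From mathcomp Require Import all_boot all_order all_algebra.
From mathcomp Require Import all_classical all_reals all_analysis.
From mathcomp Require Import ring lra.

Set Implicit Arguments.
Unset Strict Implicit.
Unset Printing Implicit Defensive.

Import Order.TTheory GRing.Theory Num.Theory.
Import numFieldNormedType.Exports.

Local Open Scope classical_set_scope.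
Local Open Scope ring_scope.

(** The ball B(x/2, |x|/2) is the set of z with <z, z> <= <x, z>; call it the
petal of x.  A star body S of E is a flower exactly when it is covered by the
petals (cut by E) that it contains: the generating set can then be taken to be
the set of all w whose petal lies in S, and this set is closed because it is
cut out by the conditions <w, y> <= <y, y>, one for each y of E outside S.
Using the open petals in its definition makes the closedness hold for every
star set S; the price, that the closed petals stick out of S by boundary
points, is invisible to the radial function and vanishes for star bodies
([petal_core], [petal_core_radial], [covered_flower_radial],
[covered_flower]).  So each operation only has to be shown to preserve being
covered by petals.

The geometric core is [petal_in_ball]: a ball containing the origin is covered
by petals.  Indeed if |c| <= |z - c|, the segment from z to c contains a point
m equidistant from 0 and z, and the ball about m through 0 and z is internally
tangent at z to the ball about c through z.  The sum of two petals, a convex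
combination of petals, and the projection of a petal to E are all balls
containing the origin, which settles Minkowski sums, convex hulls and
projections; the section of a petal by E is the petal of the projected centre.

Bounded flowers are compact, so their sums and projections are closed and a
closed star set is a star body.

The closed convex hull S needs a compactness argument.  A point z of S is a
limit of points of petals contained in the convex hull.  Writing the petal of
w = v/k as k <z, z> <= <v, z>, the pairs (v, k) may be normalised, and a limit
pair exists ([closure_petal_covered]).  If k > 0 the limit is again a petal.  If
k = 0 the petals grow to the open half-space <v, y> > 0, which S thus contains.
When <v, z> > 0, z lies in the petal of a large multiple of v.  When <v, z> = 0
and S contains a point strictly behind the hyperplane, S contains a slightly
larger half-space and the petal of z + s v fits into it for large s.
Otherwise S lies in <v, y> >= 0, so all the generators of A are non-negative
multiples of v; they are either unbounded, and A is the half-space flower of v,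
or bounded, and S lies in a single petal, which meets the hyperplane only at
the origin. *)

(** * The Euclidean structure *)

Section InnerProduct.
Context {R : realType} {n : nat}.
Implicit Types (x y z u v w c : 'rV[R]_n) (k r : R) (E : {vspace 'rV[R]_n}).

Lemma dot_sum x y : dot x y = \sum_i x 0 i * y 0 i.
Proof. by rewrite /dot mxE; apply: eq_bigr => i _; rewrite mxE. Qed.

Lemma dotC x y : dot x y = dot y x.
Proof. by rewrite !dot_sum; apply: eq_bigr => i _; rewrite mulrC. Qed.

Lemma dotDl x y z : dot (x + y) z = dot x z + dot y z.
Proof. by rewrite /dot mulmxDl mxE. Qed.

Lemma dotZl k x y : dot (k *: x) y = k * dot x y.
Proof. by rewrite /dot -scalemxAl mxE. Qed.

Lemma dotNl x y : dot (- x) y = - dot x y.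
Proof. by rewrite -scaleN1r dotZl mulN1r. Qed.

Lemma dotDr x y z : dot x (y + z) = dot x y + dot x z.
Proof. by rewrite dotC dotDl !(dotC x). Qed.

Lemma dotZr k x y : dot x (k *: y) = k * dot x y.
Proof. by rewrite dotC dotZl dotC. Qed.

Lemma dotNr x y : dot x (- y) = - dot x y.
Proof. by rewrite dotC dotNl dotC. Qed.

Lemma dot0l x : dot 0 x = 0.
Proof. by rewrite -(scale0r 0) dotZl mul0r. Qed.

Lemma dot0r x : dot x 0 = 0.
Proof. by rewrite dotC dot0l. Qed.

Definition dotE := (dotDl, dotDr, dotNl, dotNr, dotZl, dotZr, dot0l, dot0r).

Lemma dot_ge0 x : 0 <= dot x x.
Proof. by rewrite dot_sum sumr_ge0 // => i _; rewrite -expr2 sqr_ge0. Qed.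

Lemma dot_eq0 x : (dot x x == 0) = (x == 0).
Proof.
apply/eqP/eqP => [|->]; last exact: dot0l.
rewrite dot_sum => /psumr_eq0P x0; apply/rowP => i; rewrite mxE.
have /eqP : x 0 i * x 0 i = 0.
  by apply: x0 => // j _; rewrite -expr2 sqr_ge0.
by rewrite mulf_eq0 orbb => /eqP.
Qed.

Lemma dot_gt0 x : (0 < dot x x) = (x != 0).
Proof. by rewrite lt_neqAle dot_ge0 andbT eq_sym dot_eq0. Qed.

Lemma enorm_ge0 x : 0 <= enorm x.
Proof. exact: sqrtr_ge0. Qed.

Lemma enorm_sqr x : enorm x ^+ 2 = dot x x.
Proof. by rewrite sqr_sqrtr ?dot_ge0. Qed.

Lemma enorm_le x r : 0 <= r -> (enorm x <= r) = (dot x x <= r ^+ 2).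
Proof. by move=> r0; rewrite -enorm_sqr ler_sqr ?nnegrE ?enorm_ge0. Qed.

Lemma enormZ k x : enorm (k *: x) = `|k| * enorm x.
Proof.
by rewrite /enorm dotZl dotZr mulrA -expr2 sqrtrM ?sqr_ge0 // sqrtr_sqr.
Qed.

Lemma cauchy_schwarz x y : dot x y <= enorm x * enorm y.
Proof.
have [->|y0] := eqVneq y 0; first by rewrite dot0r mulr_ge0 ?enorm_ge0.
have := dot_ge0 (dot y y *: x - dot x y *: y).
rewrite !dotE (dotC y x) => h.
have {h} : dot x y ^+ 2 <= (enorm x * enorm y) ^+ 2.
  rewrite exprMn !enorm_sqr -subr_ge0 -(pmulr_rge0 _ (_ : 0 < dot y y)) ?dot_gt0 //.
  by apply: le_trans h _; rewrite le_eqVlt; apply/orP; left; apply/eqP; ring.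
move=> h; apply: le_trans (ler_norm _) _.
by rewrite -ler_sqr ?nnegrE ?mulr_ge0 ?enorm_ge0 // real_normK ?num_real.
Qed.

Lemma enormD x y : enorm (x + y) <= enorm x + enorm y.
Proof.
rewrite enorm_le ?addr_ge0 ?enorm_ge0 // !dotE (dotC y x) sqrrD !enorm_sqr.
by have := cauchy_schwarz x y; lra.
Qed.

Lemma enorm_eq0 x : (enorm x == 0) = (x == 0).
Proof. by rewrite -dot_eq0 -enorm_sqr sqrf_eq0. Qed.

(** Gram-Schmidt: the generator b of the span is replaced by its component f
orthogonal to the previous ones, and the projection of x gains its component
along f.  If f = 0 the quotient below is 0, as it should be. *)
Lemma orthogonal_decomposition E x :
  exists2 p, p \in E & forall e, e \in E -> dot (x - p) e = 0.
Proof.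
rewrite -[E](span_basis (vbasisP E)).
elim: (tval (vbasis E)) x => [|b X IH] x.
  exists 0; first exact: mem0v.
  by move=> e; rewrite span_nil memv0 => /eqP ->; rewrite dot0r.
have [p pX px] := IH x; have [q qX qb] := IH b.
set f := b - q in qb.
have sX e : e \in <<X>>%VS -> e \in <<b :: X>>%VS.
  by move=> eX; rewrite span_cons; apply: subvP eX; exact: addvSr.
have bX : b \in <<b :: X>>%VS by rewrite memv_span ?mem_head.
exists (p + (dot x f / dot f f) *: f).
  by apply: memvD (sX _ pX) (memvZ _ (memvB bX (sX _ qX))).
move=> e; rewrite span_cons => /memv_addP [_ /vlineP [k ->] [e' e'X ->]].
have xf : dot x f / dot f f * dot f f = dot x f.
  have [/eqP|f0] := eqVneq (dot f f) 0; last by rewrite mulfVK.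
  by rewrite dot_eq0 => /eqP ->; rewrite !dot0r mulr0.
set t := _ / _ in xf *.
have orthX u : u \in <<X>>%VS -> dot (x - (p + t *: f)) u = 0.
  by move=> uX; rewrite opprD addrA dotDl px // dotNl dotZl qb // mulr0 subr0.
have orthf : dot (x - (p + t *: f)) f = 0.
  by rewrite opprD addrA dotDl dotNl dotZl xf dotDl dotNl (dotC p) qb // subr0 subrr.
by rewrite -[b](subrK q) -/f (addrC f) dotDr dotZr dotDr orthf !orthX // !addr0 mulr0.
Qed.

End InnerProduct.

(** * Balls, petals and sets covered by petals *)

Section Petals.
Context {R : realType} {n : nat}.
Implicit Types (x y z u v w c : 'rV[R]_n) (k r : R) (E : {vspace 'rV[R]_n}).
Implicit Types A B S C : set 'rV[R]_n.

(** Squared form of the ball B(x/2, |x|/2): no norm occurs in it, and it is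
linear in x, which is what all closedness arguments use. *)
Definition petal x : set 'rV[R]_n := [set z | dot z z <= dot x z].

Lemma petalE x : petal x = eball (2^-1 *: x) (enorm x / 2).
Proof.
apply/seteqP; split=> z; rewrite /petal /eball /=;
  rewrite enorm_le ?divr_ge0 ?enorm_ge0 // expr_div_n enorm_sqr !dotE (dotC z x); lra.
Qed.

Lemma petal0 x : petal x 0.
Proof. by rewrite /petal /= !dot0r. Qed.

Lemma petal_self x : petal x x.
Proof. by rewrite /petal /=. Qed.

Lemma petalZ k x z : petal x z -> petal (k *: x) (k *: z).
Proof.
by rewrite /petal /= !dotZl !dotZr !mulrA => h; rewrite ler_wpM2l // -expr2 sqr_ge0.
Qed.

Lemma petals_inP E C z : petals_in E C z <-> z \in E /\ exists2 x, C x & petal x z.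
Proof.
split=> [[x Cx [xz Ez]]|[Ez [x Cx xz]]]; first by split=> //; exists x => //; rewrite petalE.
by exists x => //; split=> //; rewrite -petalE.
Qed.

(** A ball about c containing 0 is covered by petals.  If z is at least as near
to c as 0 is, the petal of 2c (the ball about c through 0) works.  Otherwise
take the ball about the point m = z + s (c - z) that is equidistant from 0 and
z; it touches the ball about c through z from inside, because m lies on the
segment from z to c.  Stated inside a subspace, for use with projections. *)
Lemma petal_in_ball E c r z : c \in E -> z \in E ->
  enorm c <= r -> enorm (z - c) <= r ->
  exists w, [/\ w \in E, petal w z & forall u, petal w u -> enorm (u - c) <= r].
Proof.
move=> cE zE cr zr.
have sub w : enorm (2^-1 *: w - c) + enorm w / 2 <= r ->
    forall u, petal w u -> enorm (u - c) <= r.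
  move=> wr u; rewrite petalE /eball /= => uw; apply: le_trans wr.
  have -> : u - c = (2^-1 *: w - c) + (u - 2^-1 *: w).
    by rewrite [RHS]addrC subrKA.
  by apply: le_trans (enormD _ _) _; rewrite lerD2l.
(* The case distinction is |z - c| <= |c| or not. *)
have [zc|zc] := leP (dot z z) (2 * dot c z).
  exists (2 *: c); split; [exact: memvZ | by rewrite /petal /= dotZl | apply: sub].
  rewrite scalerA mulVf ?pnatr_eq0 // scale1r subrr -(scale0r c) !enormZ normr0 mul0r add0r.
  by rewrite ger0_norm // mulrAC mulfV ?pnatr_eq0 // mul1r.
set d := z - c in zr.
(* The value of s for which m = z - s d satisfies |m| = |m - z| = s |d|;
   when z = 0 the quotient is 0 by convention and m = 0. *)
set s := dot z z / (2 * dot d z).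
have dz : dot z z <= 2 * dot d z by rewrite /d !dotE; lra.
have sE : s * (2 * dot d z) = dot z z.
  rewrite /s; have [h|h] := eqVneq (2 * dot d z) 0; last by rewrite divfK.
  by have := dot_ge0 z; rewrite h in dz *; lra.
have s0 : 0 <= s by rewrite divr_ge0 // ?dot_ge0 // (le_trans (dot_ge0 z)).
have s1 : s <= 1.
  rewrite /s; have [h|h] := eqVneq (2 * dot d z) 0; first by rewrite h invr0 mulr0.
  by rewrite ler_pdivrMr ?mul1r // lt_neqAle eq_sym h (le_trans (dot_ge0 z)).
exists (2 *: (z - s *: d)); split.
- by apply: memvZ; apply: memvB => //; apply: memvZ; apply: memvB.
- by rewrite /petal /= dotZl dotDl dotNl dotZl; lra.
apply: sub; rewrite scalerA mulVf ?pnatr_eq0 // scale1r addrAC -/d.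
have -> : enorm (2 *: (z - s *: d)) / 2 = s * enorm d.
  rewrite enormZ ger0_norm // mulrAC mulfV ?pnatr_eq0 // mul1r.
  rewrite -[s in RHS]ger0_norm // -enormZ /enorm; congr Num.sqrt.
  rewrite dotDl !dotDr !(dotNl, dotNr, dotZl, dotZr) (dotC z d); lra.
rewrite -{1}[d]scale1r -scalerBl enormZ ger0_norm ?subr_ge0 //.
by apply: le_trans zr; rewrite le_eqVlt; apply/orP; left; apply/eqP; ring.
Qed.

(** The displacement from the sum of the centres is shared between the two balls
in proportion to their radii. *)
Lemma eball_add c1 c2 r1 r2 u : 0 <= r1 -> 0 <= r2 ->
  eball (c1 + c2) (r1 + r2) u ->
  exists a b, [/\ u = a + b, eball c1 r1 a & eball c2 r2 b].
Proof.
rewrite /eball /= => r10 r20; set d := u - _ => du.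
pose t := r1 / (r1 + r2).
have tr : t * (r1 + r2) = r1.
  rewrite /t; have [h|h] := eqVneq (r1 + r2) 0; last by rewrite divfK.
  by rewrite h; lra.
have t0 : 0 <= t by rewrite divr_ge0 ?addr_ge0.
have t1 : t <= 1.
  rewrite /t; have [h|h] := eqVneq (r1 + r2) 0; first by rewrite h invr0 mulr0.
  by rewrite ler_pdivrMr ?mul1r ?lerDl // lt_neqAle eq_sym h addr_ge0.
exists (c1 + t *: d), (c2 + (1 - t) *: d); split.
- by rewrite addrACA -scalerDl addrC [t + _]addrC subrK scale1r subrK.
- by rewrite addrC addKr enormZ ger0_norm // -[leRHS]tr ler_wpM2l.
- rewrite addrC addKr enormZ ger0_norm ?subr_ge0 //.
  have -> : r2 = (1 - t) * (r1 + r2) by rewrite mulrBl tr mul1r addrC addKr.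
  by rewrite ler_wpM2l ?subr_ge0.
Qed.

(** The sum of the petals of x and y is the ball with centre (x + y)/2 and
radius (|x| + |y|)/2, which contains the origin. *)
Lemma petalD x y a b : petal x a -> petal y b ->
  exists w, petal w (a + b) /\
    forall u, petal w u -> exists a' b', [/\ u = a' + b', petal x a' & petal y b'].
Proof.
rewrite !petalE => xa yb.
pose c := 2^-1 *: x + 2^-1 *: y; pose r := enorm x / 2 + enorm y / 2.
have half z : enorm (2^-1 *: z) = enorm z / 2 by rewrite enormZ ger0_norm ?invr_ge0 // mulrC.
have cr : enorm c <= r by rewrite (le_trans (enormD _ _)) // !half.
have zr : enorm (a + b - c) <= r.
  rewrite /c opprD addrACA; apply: le_trans (enormD _ _) _; exact: lerD.
have [w [_ wz wu]] := petal_in_ball (memvf c) (memvf (a + b)) cr zr.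
exists w; split=> // u /wu /eball_add [||a' [b' [-> ? ?]]]; rewrite ?divr_ge0 ?enorm_ge0 //.
by exists a', b'.
Qed.

Definition petal_covered E S := forall z, S z ->
  exists w, [/\ w \in E, petal w z & forall u, u \in E -> petal w u -> S u].

Lemma petal_covered_add A B : petal_covered fullv A -> petal_covered fullv B ->
  petal_covered fullv (minkowski_sum A B).
Proof.
move=> cA cB _ [a Aa [b Bb <-]].
have [x [_ xa xA]] := cA _ Aa; have [y [_ yb yB]] := cB _ Bb.
have [w [wz wu]] := petalD xa yb; exists w; split=> //; first exact: memvf.
move=> u _ /wu [a' [b' [-> /(xA _ (memvf _)) ? /(yB _ (memvf _)) ?]]].
by exists a' => //; exists b'.
Qed.

(** If p is the projection of x to E then <p, u> = <x, u> for u in E: the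
petals of x and p have the same section by E. *)
Lemma petal_covered_cap E A : petal_covered fullv A -> petal_covered E (A `&` [set` E]).
Proof.
move=> cA z [Az /= zE]; have [x [_ xz xA]] := cA _ Az.
have [p pE xp] := orthogonal_decomposition E x.
have dE u : u \in E -> dot p u = dot x u.
  by move=> /xp; rewrite dotDl dotNl => /eqP; rewrite subr_eq0 => /eqP.
exists p; split=> //; rewrite /petal /= ?dE // => u uE.
by rewrite dE // => xu; split=> //; apply: xA (memvf _) _.
Qed.

(** The projection to E of the petal of x is the ball of E with centre p/2 and
radius |x|/2, where p is the projection of x; it contains the origin since
|p| <= |x|. *)
Lemma petal_covered_proj E A : petal_covered fullv A -> petal_covered E (orth_proj E A).
Proof.
move=> cA z [zE [a Aa az]]; have [x [_ xa xA]] := cA _ Aa.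
have [p pE xp] := orthogonal_decomposition E x.
(* A point u of the projected ball lifts to u + f/2, where f is the part of x
   orthogonal to E. *)
pose f := x - p; pose r := enorm x / 2; pose c := 2^-1 *: p.
have r0 : 0 <= r by rewrite divr_ge0 ?enorm_ge0.
have cE : c \in E by exact: memvZ.
have cr : enorm c <= r.
  rewrite enorm_le // expr_div_n enorm_sqr.
  have := xp _ pE; have := dot_ge0 f; rewrite /f /c !dotE (dotC p x); lra.
have zr : enorm (z - c) <= r.
  rewrite enorm_le // expr_div_n enorm_sqr.
  have h1 := dot_ge0 ((a - z) - 2^-1 *: f).
  have h2 := az _ (memvB zE cE); have h3 := xp _ (memvB zE cE).
  have : dot (a - 2^-1 *: x) (a - 2^-1 *: x) <= dot x x / 4.
    by move: xa; rewrite /petal /= !dotE (dotC a x); lra.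
  have -> : a - 2^-1 *: x = ((a - z) - 2^-1 *: f) + (z - c).
    by rewrite /f /c scalerBr; apply/rowP => i; rewrite !mxE; ring.
  have h4 : dot ((a - z) - 2^-1 *: f) (z - c) = 0.
    by rewrite dotDl dotNl dotZl h2 /f h3 mulr0 subrr.
  rewrite (dotDl _ (z - c)) !(dotDr _ _ (z - c)) h4 (dotC (z - c)) h4.
  by rewrite add0r addr0 => h5; lra.
have [w [wE wz wu]] := petal_in_ball cE zE cr zr.
exists w; split=> // u uE /wu ur; split=> //.
exists (u + 2^-1 *: f).
  apply: xA (memvf _) _; rewrite petalE /eball /=.
  suff -> : u + 2^-1 *: f - 2^-1 *: x = u - c by [].
  by rewrite /f /c scalerBr; apply/rowP => i; rewrite !mxE; ring.
by move=> e eE; rewrite addrC addKr dotZl xp // mulr0.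
Qed.

End Petals.

(** * Radial functions of sets covered by petals *)

Section Radial.
Context {R : realType} {n : nat}.
Implicit Types (x y z t w : 'rV[R]_n) (l m : R) (E : {vspace 'rV[R]_n}).
Implicit Types A B S C : set 'rV[R]_n.

Lemma star_set0 S : star_set S -> S 0.
Proof. by move=> [[x Sx] h]; rewrite -(scale0r x); apply: h; rewrite ?lexx ?ler01. Qed.

Lemma star_set_le S l m x : star_set S -> 0 <= l <= m -> S (m *: x) -> S (l *: x).
Proof.
move=> sS /andP[l0 lm] Sm; have [m0|m0] := eqVneq m 0.
  suff -> : l = 0 by rewrite scale0r; exact: star_set0.
  by apply/eqP; rewrite eq_le l0 -m0 lm.
have mp : 0 < m by rewrite lt_neqAle eq_sym m0 (le_trans l0).
have -> : l *: x = (l / m) *: (m *: x) by rewrite scalerA divfK.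
by apply: sS.2 => //; rewrite divr_ge0 ?(ltW mp) //= ler_pdivrMr // mul1r.
Qed.

Lemma radial_ge S l t : 0 <= l -> S (l *: t) -> (l%:E <= radial S t)%E.
Proof. by move=> l0 Sl; apply: ereal_sup_ubound; exists l. Qed.

Lemma radial_ge0 S t : star_set S -> (0 <= radial S t)%E.
Proof. by move=> sS; apply: radial_ge => //; rewrite scale0r; exact: star_set0. Qed.

Lemma star_body_radial E S l t : star_body_in E S -> t \in E -> enorm t = 1 ->
  0 <= l -> (l%:E <= radial S t)%E -> S (l *: t).
Proof.
move=> [sS _ bS] tE t1 l0 lr; have [rfin|] := ltP (radial S t) +oo%E.
  apply: star_set_le (bS _ tE t1 rfin) => //; rewrite l0 -lee_fin fineK //.
  by rewrite ge0_fin_numE // radial_ge0.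
rewrite leye_eq => /eqP roo.
have : (l%:E < radial S t)%E by rewrite roo ltry.
case/ereal_sup_gt => _ [m [m0 Sm] <-]; rewrite lte_fin => /ltW lm.
by apply: star_set_le Sm; rewrite ?l0.
Qed.

(** The points whose petal lies in S, except that only the open petal is
required to: this makes the set closed for every S, and costs nothing at the
level of radial functions. *)
Definition petal_core E S : set 'rV[R]_n :=
  [set w | w \in E /\ forall y, y \in E -> dot y y < dot w y -> S y].

(** Every l' with 0 < l' < l gives a point of the open petal, hence of S. *)
Lemma petal_core_radial E S w l t : star_set S -> petal_core E S w ->
  t \in E -> enorm t = 1 -> 0 <= l -> petal w (l *: t) -> (l%:E <= radial S t)%E.
Proof.
move=> sS [wE wS] tE t1 l0 wlt; rewrite leNgt; apply/negP => rl.
have rfin : radial S t \is a fin_num by rewrite ge0_fin_numE ?radial_ge0 // (lt_trans rl) // ltry.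
have := radial_ge0 t sS; move: rl; rewrite -(fineK rfin); set r := fine _.
rewrite lte_fin lee_fin => rl r0.
have tt : dot t t = 1 by rewrite -enorm_sqr t1 expr1n.
have lw : l <= dot w t.
  have lp : 0 < l by exact: le_lt_trans rl.
  by move: wlt; rewrite /petal /= dotZl !dotZr tt mulr1 ler_pM2l.
(* A point strictly between the supremum r and l gives the contradiction. *)
pose m := (r + l) / 2.
have rm : r < m by rewrite /m; lra.
have ml : m < l by rewrite /m; lra.
have mp : 0 < m by exact: le_lt_trans rm.
have : S (m *: t).
  apply: wS; first exact: memvZ.
  by rewrite dotZl !dotZr tt mulr1 ltr_pM2l // (lt_le_trans ml).
move=> /(radial_ge (ltW mp)); rewrite -(fineK rfin) lee_fin -/r.
by rewrite leNgt rm.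
Qed.

Lemma unit_vector z : z != 0 ->
  enorm ((enorm z)^-1 *: z) = 1 /\ z = enorm z *: ((enorm z)^-1 *: z).
Proof.
move=> z0; have e0 : enorm z != 0 by rewrite enorm_eq0.
by rewrite enormZ ger0_norm ?invr_ge0 ?enorm_ge0 // mulVf // scalerA mulfV // scale1r.
Qed.

(** For a star body the boundary of the petal is recovered from its interior,
since the radial supremum is attained. *)
Lemma petal_core_sub E S w z : star_body_in E S -> petal_core E S w ->
  z \in E -> petal w z -> S z.
Proof.
move=> bS cw zE wz; have sS : star_set S by case: bS.
have [->|/unit_vector [u1 zu]] := eqVneq z 0; first exact: star_set0.
rewrite zu in wz *; have uE := memvZ (enorm z)^-1 zE.
apply: (star_body_radial bS uE u1); rewrite ?enorm_ge0 //.
by apply: (petal_core_radial sS cw uE u1) wz; rewrite ?enorm_ge0.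
Qed.

Lemma petal_covered_core E S z : petal_covered E S -> S z ->
  exists2 w, petal_core E S w & petal w z.
Proof.
by move=> cS /cS [w [wE wz wS]]; exists w => //; split=> // y yE /ltW; exact: wS.
Qed.

Lemma flower_covered A : flower A -> petal_covered fullv A.
Proof.
move=> [_ [C [_ _ ->]]] z /petals_inP [_ [x Cx xz]].
exists x; split=> //; first exact: memvf.
by move=> u _ xu; apply/petals_inP; split; [exact: memvf|exists x].
Qed.

End Radial.

(** * Closedness, and the criterion for flowers *)

Section Topology.
Context {R : realType} {n : nat}.
Implicit Types (x y z t w : 'rV[R]_n) (E : {vspace 'rV[R]_n}).
Implicit Types A B S C : set 'rV[R]_n.

Lemma continuous_dot (T : topologicalType) (f g : T -> 'rV[R]_n) :
  continuous f -> continuous g -> continuous (fun s => dot (f s) (g s)).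
Proof.
move=> cf cg; have -> : (fun s => dot (f s) (g s)) = fun s => \sum_i f s 0 i * g s 0 i.
  by apply/funext => s; rewrite dot_sum.
have coord (h : T -> 'rV[R]_n) i : continuous h -> continuous (fun s => h s 0 i).
  move=> ch s; apply: (@continuous_comp _ _ _ h (fun M : 'rV[R]_n => M 0 i)); first exact: ch.
  exact: coord_continuous.
elim: (index_enum _) => [|i r IH].
  under [X in continuous X]eq_fun do rewrite big_nil.
  exact: cst_continuous.
under [X in continuous X]eq_fun do rewrite big_cons.
move=> s; apply: cvgD; last exact: IH.
by apply: cvgM; exact: coord.
Qed.

Lemma closed_le_fun (T : topologicalType) (f g : T -> R) :
  continuous f -> continuous g -> closed [set s | f s <= g s].
Proof.
move=> cf cg; have -> : [set s | f s <= g s] = (fun s => f s - g s) @^-1` [set r | r <= 0].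
  by apply/seteqP; split=> s /=; rewrite subr_le0.
have /continuous_closedP : continuous (fun s => f s - g s).
  by move=> s; apply: cvgB; [exact: cf|exact: cg].
by apply; exact: closed_le.
Qed.

(** A subspace is the orthogonal of its orthogonal. *)
Lemma vspace_closed E : closed [set` E].
Proof.
have -> : [set` E] = \bigcap_(f in [set f | forall e, e \in E -> dot f e = 0])
    [set x | dot x f <= 0].
  apply/seteqP; split=> [x /= xE f fE|x /= h]; first by rewrite /= dotC fE.
  have [p pE xp] := orthogonal_decomposition E x.
  have /= : dot x (x - p) <= 0 by exact: h.
  have := xp _ pE; rewrite (dotC x) => pp xx.
  suff : x - p == 0 by rewrite subr_eq0 => /eqP ->.
  by rewrite -dot_eq0 eq_le dot_ge0 andbT dotDr dotNr pp oppr0 addr0.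
apply: closed_bigI => f _; apply: closed_le_fun; last exact: cst_continuous.
by apply: continuous_dot; [move=> ?; exact: cvg_id|exact: cst_continuous].
Qed.

(** Contraposition turns the definition into a conjunction of the weak linear
inequalities <w, y> <= <y, y>, for y in E outside S. *)
Lemma petal_core_closed E S : closed (petal_core E S).
Proof.
have -> : petal_core E S = [set` E] `&`
    \bigcap_(y in [set y | y \in E /\ ~ S y]) [set w | dot w y <= dot y y].
  apply/seteqP; split=> w [wE wS]; split=> // y /=.
    by move=> [yE nSy]; rewrite leNgt; apply/negP => /(wS _ yE).
  by move=> yE yw; apply: contrapT => nSy; have := wS y (conj yE nSy); rewrite /= leNgt yw.
apply: closedI; first exact: vspace_closed.
apply: closed_bigI => y _; apply: closed_le_fun; last exact: cst_continuous.
by apply: continuous_dot; [move=> ?; exact: cvg_id|exact: cst_continuous].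
Qed.

Lemma covered_flower_radial E S : star_set S -> S `<=` [set` E] ->
  petal_covered E S -> flower_radial_in E S.
Proof.
move=> sS SE cS; split=> //; exists (petal_core E S); split.
- by have [w cw _] := petal_covered_core cS (star_set0 sS); exists w.
- exact: petal_core_closed.
- by move=> w [].
move=> t tE t1; apply/eqP; rewrite eq_le; apply/andP; split.
  apply: ereal_sup_le => _ [l [l0 Sl] <-]; exists l => //; split=> //.
  apply/petals_inP; split; first exact: memvZ.
  by have [w cw wl] := petal_covered_core cS Sl; exists w.
apply: ge_ereal_sup => _ [l [l0 /petals_inP [_ [w cw wl]]] <-].
exact: petal_core_radial cw tE t1 l0 wl.
Qed.

Lemma covered_flower E S : petal_covered E S -> star_body_in E S -> flower_in E S.
Proof.
move=> cS bS; split=> //; exists (petal_core E S); split.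
- exact: petal_core_closed.
- by move=> w [].
have [_ SE _] := bS.
apply/seteqP; split=> z; last first.
  by move=> /petals_inP [zE [w cw wz]]; exact: petal_core_sub cw zE wz.
move=> Sz; apply/petals_inP; split; first exact: SE.
by have [w cw wz] := petal_covered_core cS Sz; exists w.
Qed.

Lemma closed_star_body E S : star_set S -> S `<=` [set` E] -> closed S -> star_body_in E S.
Proof.
move=> sS SE clS; split=> // t _ _ rfin.
pose L := [set l : R | 0 <= l /\ S (l *: t)].
have L0 : L !=set0 by exists 0; split=> //; rewrite scale0r; exact: star_set0.
have rf : radial S t \is a fin_num by rewrite ge0_fin_numE // radial_ge0.
have Lb : has_ubound L.
  by exists (fine (radial S t)) => l [l0 Sl]; rewrite -lee_fin fineK //; exact: radial_ge.
have -> : fine (radial S t) = sup L by rewrite /radial ereal_sup_EFin.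
suff /(_ _ (closure_sup L0 Lb)) [] : closed L by [].
apply: closedI; first exact: closed_ge.
have /continuous_closedP : continuous (fun l : R => l *: t) by exact: scalel_continuous.
exact.
Qed.

(** The projection along a compact factor is a closed map (tube lemma).  All the
closedness results on flowers, sums and projections come from it. *)
Lemma closed_exists_compact (X Y : topologicalType) (Q : set X) (F : set (X * Y)) :
  compact Q -> closed F -> closed [set p | exists2 q, Q q & F (q, p)].
Proof.
move=> /compact_near_coveringP Qc; rewrite closedE => Fc; rewrite -openC openE => p np.
have : \forall p' \near p, Q `<=` [set q | ~ F (q, p')].
  apply: Qc => q Qq.
  have nF : ~ F (q, p) by move=> Fqp; apply: np; exists q.
  by apply: filterS (contrapT (contra_not (@Fc (q, p)) nF)) => -[].
apply: filterS => p' h [q Qq]. exact: (h q Qq).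
Qed.

End Topology.

(** * Convex hulls, sums, projections and sections *)

Section Operations.
Context {R : realType} {n : nat}.
Implicit Types (x y z u v w : 'rV[R]_n) (k t : R) (E : {vspace 'rV[R]_n}).
Implicit Types A B S C M : set 'rV[R]_n.

Lemma convex_setP M : convex_set M <->
  forall x y t, 0 <= t <= 1 -> M x -> M y -> M (t *: x + (1 - t) *: y).
Proof.
split=> [cM x y t /andP[t0 t1] Mx My|cM x y t].
  by have := cM x y (Itv01 t0 t1); rewrite !inE; apply.
by rewrite !inE => Mx My; apply: cM => //; apply/andP; split.
Qed.

Lemma convex_star_set M : convex_set M -> M 0 -> star_set M.
Proof.
move=> /convex_setP cM M0; split; first by exists 0.
by move=> x l Mx l01; have := cM x 0 l l01 Mx M0; rewrite scaler0 addr0.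
Qed.

Lemma petalZ_inv k x z : petal (k *: x) z -> exists2 z', petal x z' & z = k *: z'.
Proof.
have [->|k0] := eqVneq k 0 => kxz.
  exists 0; first exact: petal0.
  move: kxz; rewrite /petal /= scale0r dot0l scale0r => h.
  by apply/eqP; rewrite -dot_eq0 eq_le h dot_ge0.
exists (k^-1 *: z); last by rewrite scalerA mulfV // scale1r.
by rewrite -(scale1r x) -(mulVf k0) -scalerA; exact: petalZ.
Qed.

(** A petal is a ball; here convexity follows from
t (1 - t) |y - z|^2 >= 0. *)
Lemma petal_convex x : convex_set (petal x).
Proof.
apply/convex_setP => y z t /andP[t0 t1]; rewrite /petal /= => xy xz.
have t1' : 0 <= 1 - t by rewrite subr_ge0.
have h1 : 0 <= t * (1 - t) * dot (y - z) (y - z) by rewrite !mulr_ge0 ?dot_ge0.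
have h2 : t * dot y y <= t * dot x y by rewrite ler_wpM2l.
have h3 : (1 - t) * dot z z <= (1 - t) * dot x z by rewrite ler_wpM2l.
move: h1; rewrite !dotE (dotC z y) => h1; nra.
Qed.

Lemma smallest_convex (P : set 'rV[R]_n -> Prop) A :
  (forall M, P M -> convex_set M) -> convex_set (smallest P A).
Proof.
move=> Pc; apply/convex_setP => x y t t01 Sx Sy M [PM AM].
by apply: ((convex_setP M).1 (Pc _ PM)) => //; [exact: Sx|exact: Sy].
Qed.

Lemma convex_hull_convex A : convex_set (convex_hull A).
Proof. exact: smallest_convex. Qed.

Lemma closed_convex_hull_convex A : convex_set (closed_convex_hull A).
Proof. by apply: smallest_convex => M []. Qed.

Lemma closed_convex_hull_closed A : closed (closed_convex_hull A).
Proof. by apply: closed_bigI => M [[]]. Qed.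

(** For a fixed point of M in one argument, then for a fixed point of the closure
in the other, convex combination is a continuous map under which the preimage
of the closure is closed and contains M. *)
Lemma closure_convex M : convex_set M -> convex_set (closure M).
Proof.
move=> /convex_setP cM; apply/convex_setP => x y t t01.
have comb (f : 'rV[R]_n -> 'rV[R]_n) : continuous f -> (forall z, M z -> closure M (f z)) ->
    forall z, closure M z -> closure M (f z).
  move=> /continuous_closedP/(_ _ (@closed_closure _ M)) fM Mf z.
  by rewrite {1}closureE => /(smallest_sub fM Mf).
have caff k1 k2 w : continuous (fun z : 'rV[R]_n => k1 *: z + k2 *: w).
  by move=> z; apply: continuousD; [apply: scaler_continuous|apply: cst_continuous].
have left_in z : M z -> forall y', closure M y' -> closure M ((1 - t) *: y' + t *: z).
  move=> Mz; apply: (comb _ (caff _ _ _)) => y' My'; rewrite addrC.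
  by apply: subset_closure; exact: cM.
move=> + cy; apply: (comb _ (caff _ _ _)) x => z Mz.
by rewrite addrC; exact: left_in.
Qed.

(** The points that lie in a petal contained in the convex hull form a convex
set: a combination of two petals is a sum of two petals, to which [petalD]
applies. *)
Lemma petal_covered_conv A : petal_covered fullv A -> petal_covered fullv (convex_hull A).
Proof.
move=> cA; set S := convex_hull A.
have cS := (convex_setP _).1 (@convex_hull_convex A).
pose P := [set z | exists w, [/\ w \in fullv, petal w z &
  forall u, u \in fullv -> petal w u -> S u]].
apply: (@smallest_sub _ _ _ P); last first.
  move=> z /cA [w [wf wz wA]]; exists w; split=> // u uf wu.
  by apply: sub_gen_smallest; exact: wA.
apply/convex_setP => x y t t01 [v [_ vx vS]] [w [_ wy wS]].
have [p [pz pS]] := petalD (petalZ t vx) (petalZ (1 - t) wy).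
exists p; split=> //; first exact: memvf.
move=> u _ /pS [a [b [-> va wb]]].
have [a' va' ->] := petalZ_inv va; have [b' wb' ->] := petalZ_inv wb.
by apply: cS => //; [apply: vS|apply: wS] => //; exact: memvf.
Qed.

Lemma star_set_add A B : star_set A -> star_set B -> star_set (minkowski_sum A B).
Proof.
move=> sA sB; split.
  by exists 0, 0; [exact: star_set0|exists 0; [exact: star_set0|rewrite addr0]].
move=> _ l [a Aa [b Bb <-]] l01; exists (l *: a); first exact: sA.2.
by exists (l *: b); [exact: sB.2|rewrite scalerDr].
Qed.

Lemma star_set_proj E A : star_set A -> star_set (orth_proj E A).
Proof.
move=> sA; split.
  exists 0; split; first exact: mem0v.
  by exists 0; [exact: star_set0|move=> e _; rewrite subrr dot0l].
move=> x l [xE [a Aa ax]] l01; split; first exact: memvZ.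
by exists (l *: a); [exact: sA.2|move=> e eE; rewrite -scalerBr dotZl ax // mulr0].
Qed.

Lemma star_body_cap E A : star_body A -> star_body_in E (A `&` [set` E]).
Proof.
move=> [sA _ bA]; split=> //.
  split; first by exists 0; split; [exact: star_set0|exact: mem0v].
  by move=> x l [Ax xE] l01; split; [exact: sA.2|exact: memvZ].
move=> t tE t1; have -> : radial (A `&` [set` E]) t = radial A t.
  congr ereal_sup; apply/seteqP; split=> _ [l [l0 lA] <-]; exists l => //; split=> //.
    by case: lA.
  by split=> //; exact: memvZ.
by move=> rfin; split; [apply: bA => //; exact: memvf|exact: memvZ].
Qed.

(** The generators of a flower belong to it, so they form a compact set, and the
union of a compact family of petals is closed. *)
Lemma bounded_flower_compact A : flower A -> bounded_set A -> compact A.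
Proof.
move=> [_ [C [clC _ AE]]] bA; apply: bounded_closed_compact => //.
have CA : C `<=` A.
  by move=> x Cx; rewrite AE; apply/petals_inP; split; [exact: memvf|exists x => //; exact: petal_self].
have cC : compact C.
  apply: bounded_closed_compact clC; case: bA => M [Mr bA].
  by exists M; split=> // m /bA h x /CA; exact: h.
have -> : A = [set z | exists2 x, C x & [set p | dot p.2 p.2 <= dot p.1 p.2] (x, z)].
  rewrite AE; apply/seteqP; split=> z; first by move=> /petals_inP [].
  by move=> h; apply/petals_inP; split; [exact: memvf|].
apply: closed_exists_compact => //.
by apply: closed_le_fun; apply: continuous_dot => p; by [exact: cvg_fst|exact: cvg_snd].
Qed.

Lemma closed_add A B : compact A -> closed B -> closed (minkowski_sum A B).
Proof.
move=> cA clB; have -> : minkowski_sum A B =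
    [set z | exists2 a, A a & [set p | B (p.2 - p.1)] (a, z)].
  apply/seteqP; split=> z /=.
    by move=> [a Aa [b Bb <-]]; exists a => //; rewrite addrC addKr.
  by move=> [a Aa Bz]; exists a => //; exists (z - a) => //; rewrite addrC subrK.
apply: closed_exists_compact => //.
apply: (continuous_closedP _).1 clB => p.
by apply: cvgB; [exact: cvg_snd|exact: cvg_fst].
Qed.

Lemma closed_proj E A : compact A -> closed (orth_proj E A).
Proof.
move=> cA; pose F := [set p : 'rV[R]_n * 'rV[R]_n | p.2 \in E] `&`
  \bigcap_(e in [set` E]) [set p | dot (p.1 - p.2) e <= 0].
have -> : orth_proj E A = [set y | exists2 a, A a & F (a, y)].
  apply/seteqP; split=> y.
    by move=> [yE [a Aa ay]]; exists a => //; split=> // e eE; rewrite /= ay.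
  move=> [a Aa [yE ay]]; split=> //; exists a => // e eE.
  apply/eqP; rewrite eq_le; apply/andP; split; first exact: ay.
  by have := ay (- e); rewrite /= dotNr oppr_le0; apply; rewrite memvN.
apply: closed_exists_compact => //; apply: closedI.
  apply: (continuous_closedP _).1 (@vspace_closed _ _ E) => p.
  exact: cvg_snd.
apply: closed_bigI => e _; apply: closed_le_fun; last exact: cst_continuous.
apply: continuous_dot; last exact: cst_continuous.
by move=> p; apply: cvgB; [exact: cvg_fst|exact: cvg_snd].
Qed.

End Operations.

(** * The closed convex hull *)

Section ClosedConvexHull.
Context {R : realType} {n : nat}.
Implicit Types (x y z u v w : 'rV[R]_n) (k t : R).
Implicit Types A S C M : set 'rV[R]_n.

(** Petals with homogeneous parameters: for k > 0 the inequality
k <y, y> <= <v, y> defines the petal of v/k, and for k = 0, v != 0, it defines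
a half-space, the limit of ever larger petals.  The parameters can be
normalised to a compact set, so a limit of points of petals of M satisfies the
inequality for a limit parameter, and the corresponding open petal or open
half-space lies in the closure of M. *)
Lemma closure_petal_covered M z : petal_covered fullv M -> closure M z ->
  exists v k, [/\ 0 <= k, k = 0 -> v != 0,
    forall y, k * dot y y < dot v y -> closure M y & k * dot z z <= dot v z].
Proof.
move=> cM clz.
pose Q := [set q : 'rV[R]_n * R | `|q.1| <= 1 /\ 0 <= q.2 <= 1] `&`
  ([set q | 1 <= `|q.1| + q.2] `&`
   \bigcap_(y in ~` closure M) [set q | dot q.1 y <= q.2 * dot y y]).
have cfst : continuous (fun q : 'rV[R]_n * R => q.1) by move=> q; exact: cvg_fst.
have csnd : continuous (fun q : 'rV[R]_n * R => q.2) by move=> q; exact: cvg_snd.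
have cnorm : continuous (fun x : 'rV[R]_n => `|x|) by move=> x; exact: norm_continuous.
have cQ : compact Q.
  have cK : compact ([set x : 'rV[R]_n | `|x| <= 1] `*` (`[0, 1]%classic : set R)).
    apply: compact_setX; last exact: segment_compact.
    apply: bounded_closed_compact.
      exists (1 : R); split; first exact: num_real.
      by move=> m m1 x /= x1; rewrite (le_trans x1) // ltW.
    by apply: closed_le_fun => //; exact: cst_continuous.
  apply: subclosed_compact cK _; last first.
    by move=> q [[q1 q2] _]; split; rewrite //= in_itv.
  apply: closedI.
    have -> : [set q : 'rV[R]_n * R | `|q.1| <= 1 /\ 0 <= q.2 <= 1] =
      [set q | `|q.1| <= 1] `&` ([set q | 0 <= q.2] `&` [set q | q.2 <= 1]).
      apply/seteqP; split=> q /=; first by case=> ? /andP[].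
      by case=> ? [? ?]; split=> //; apply/andP.
    apply: closedI; [|apply: closedI]; apply: closed_le_fun => //; try exact: cst_continuous.
    by move=> q; apply: (@continuous_comp _ _ _ fst); [exact: cfst|exact: cnorm].
  apply: closedI.
    apply: closed_le_fun; first exact: cst_continuous.
    move=> q; apply: cvgD; last exact: csnd.
    by apply: (@continuous_comp _ _ _ fst); [exact: cfst|exact: cnorm].
  apply: closed_bigI => y _; apply: closed_le_fun.
    by apply: continuous_dot => //; exact: cst_continuous.
  by move=> q; apply: cvgM; [exact: csnd|exact: cvg_cst].
(* The points satisfying the inequality for some normalised parameter. *)
pose G := [set x | exists2 q, Q q & [set p : ('rV[R]_n * R) * 'rV[R]_n |
  p.1.2 * dot p.2 p.2 <= dot p.1.1 p.2] (q, x)].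
have clG : closed G.
  apply: closed_exists_compact => //.
  have c1 : continuous (fun p : ('rV[R]_n * R) * 'rV[R]_n => p.1) by move=> p; exact: cvg_fst.
  have c2 : continuous (fun p : ('rV[R]_n * R) * 'rV[R]_n => p.2) by move=> p; exact: cvg_snd.
  apply: closed_le_fun.
    move=> p; apply: cvgM; last exact: continuous_dot.
    by apply: (@continuous_comp _ _ _ fst snd); [exact: c1|exact: csnd].
  apply: continuous_dot => // p.
  by apply: (@continuous_comp _ _ _ fst fst); [exact: c1|exact: cfst].
have MG : M `<=` G.
  move=> x /cM [w [_ wx wM]]; have w1 : 0 < `|w| + 1 by rewrite ltr_wpDl.
  have k0 : 0 < (`|w| + 1)^-1 by rewrite invr_gt0.
  (* The petal of w has parameters (w, 1), before normalisation. *)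
  exists ((`|w| + 1)^-1 *: w, (`|w| + 1)^-1); last first.
    by rewrite /= dotZl ler_wpM2l // ltW.
  have nw : `|(`|w| + 1)^-1 *: w| = (`|w| + 1)^-1 * `|w|.
    by rewrite normrZ gtr0_norm.
  split; [split|split] => /=.
  - by rewrite nw mulrC ler_pdivrMr // mul1r lerDl.
  - by rewrite ltW //= invf_le1 // lerDr.
  - by rewrite nw -[X in _ + X]mulr1 -mulrDr mulVf // gt_eqF.
  - move=> y ncy; rewrite /= dotZl ler_wpM2l ?(ltW k0) // leNgt; apply/negP => yw.
    by apply: ncy; apply: subset_closure; apply: wM; [exact: memvf|exact: ltW].
have : G z by move: clz; rewrite closureE => /(smallest_sub clG MG).
move=> [[v k] [[/= _ /andP[k0 _]] [vk hk]] /= kz]; exists v, k; split=> //.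
  move=> kE; apply: contraTneq vk => ->; by rewrite kE normr0 addr0 -ltNge ltr01.
by move=> y ky; apply: contrapT => /hk; rewrite /= leNgt ky.
Qed.

(** Such a y lies on the segment from y0 to y0 + e (y - y0), and the latter point
is in front of the hyperplane as soon as e is large. *)
Lemma convex_half_space_extend v y0 S : convex_set S ->
  (forall y, 0 < dot v y -> S y) -> S y0 ->
  forall y, dot v y0 < dot v y -> S y.
Proof.
move=> /convex_setP cS vS Sy0 y vy.
pose d := dot v y - dot v y0; have d0 : 0 < d by rewrite subr_gt0.
(* With this e, <v, y0 + e (y - y0)> = <v, y0> + d + |<v, y0>| > 0. *)
pose e := 1 + `|dot v y0| / d.
have e1 : 1 <= e by rewrite lerDl divr_ge0 // ltW.
have e0 : 0 < e by exact: lt_le_trans e1.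
have -> : y = e^-1 *: (y0 + e *: (y - y0)) + (1 - e^-1) *: y0.
  rewrite scalerDr scalerA mulVf ?gt_eqF // scale1r scalerBl scale1r.
  by apply/rowP => i; rewrite !mxE; ring.
apply: cS => //; first by rewrite invr_ge0 ltW //= invf_le1.
apply: vS; rewrite dotDr dotZr dotDr dotNr -/d.
have -> : e * d = d + `|dot v y0| by rewrite mulrDl mul1r divfK // gt_eqF.
by have := ler_norm (- dot v y0); rewrite normrN; lra.
Qed.

(** The lowest point of the petal of x in the direction v is (x - b v)/2, with
b = |x|/|v|.  That it lies in the half-space forces the equality case
<x, v> = |x| |v| of Cauchy-Schwarz. *)
Lemma petal_in_half_space_center C v : v != 0 ->
  (forall y, petals_in fullv C y -> 0 <= dot v y) ->
  forall x, C x -> x = (enorm x / enorm v) *: v.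
Proof.
move=> v0 hC x Cx; set b := enorm x / enorm v.
have ev : 0 < enorm v by rewrite lt_neqAle eq_sym enorm_eq0 v0 enorm_ge0.
have bv : b * dot v v = enorm x * enorm v.
  by rewrite -enorm_sqr expr2 mulrA divfK // gt_eqF.
have bbv : b ^+ 2 * dot v v = dot x x.
  by rewrite -enorm_sqr -exprMn divfK ?gt_eqF // enorm_sqr.
have : 0 <= dot v (2^-1 *: (x - b *: v)).
  apply: hC; apply/petals_inP; split; first exact: memvf.
  exists x => //; rewrite /petal /= !dotE (dotC v x); lra.
rewrite !dotE (dotC v x) => h.
apply/eqP; rewrite -subr_eq0 -dot_eq0 eq_le dot_ge0 andbT.
have b0 : 0 <= b by rewrite divr_ge0 ?enorm_ge0.
have : b * (b * dot v v) <= b * dot x v by rewrite ler_wpM2l //; lra.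
rewrite !dotE (dotC v x); lra.
Qed.

Lemma closed_convex_hull_covered A : flower A ->
  (forall u, u != 0 -> A <> half_space_flower u) ->
  petal_covered fullv (closed_convex_hull A).
Proof.
move=> fA nA z; set S := closed_convex_hull A => Sz.
have sA : star_set A by case: fA => [[]].
have cS : convex_set S by exact: closed_convex_hull_convex.
have AS : A `<=` S by exact: sub_gen_smallest.
have S0 : S 0 by apply: AS; exact: star_set0.
have sS : star_set S by exact: convex_star_set.
have bS : star_body_in fullv S.
  apply: closed_star_body => //; first by move=> y _; exact: memvf.
  exact: closed_convex_hull_closed.
have clS : closure (convex_hull A) `<=` S.
  rewrite closureE; apply: smallest_sub; first exact: closed_convex_hull_closed.
  by apply: smallest_sub.
have Scl : S `<=` closure (convex_hull A).
  apply: smallest_sub.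
    by split; [exact/closure_convex/convex_hull_convex|exact: closed_closure].
  by move=> x Ax; apply: subset_closure; apply: sub_gen_smallest.
have core w : (forall y, dot y y < dot w y -> S y) -> petal w z ->
    exists w, [/\ w \in fullv, petal w z & forall u, u \in fullv -> petal w u -> S u].
  move=> wS wz; exists w; split=> //; first exact: memvf.
  move=> u uf; apply: petal_core_sub bS _ uf; split; first exact: memvf.
  by move=> y _; exact: wS.
have [v [k [k0 vk vS kz]]] :=
  closure_petal_covered (petal_covered_conv (flower_covered fA)) (Scl _ Sz).
have {}vS y : k * dot y y < dot v y -> S y by move=> /vS /clS.
have [kE|kN] := eqVneq k 0; last first.
  have kp : 0 < k by rewrite lt_neqAle eq_sym kN.
  (* A limit of petals of bounded size. *)
  apply: (core (k^-1 *: v)) => [y|]; rewrite /petal /= dotZl.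
    by rewrite ltr_pdivlMl // => /vS.
  by rewrite ler_pdivlMl.
have {vk} v0 := vk kE; subst k.
have {}vS y : 0 < dot v y -> S y by move=> vy; apply: vS; rewrite mul0r.
rewrite mul0r in kz.
have [->|z0] := eqVneq z 0.
  exists 0; split; [exact: memvf|exact: petal0|move=> u _].
  rewrite /petal /= dot0l => h; suff -> : u = 0 by [].
  by apply/eqP; rewrite -dot_eq0 eq_le h dot_ge0.
have [vz|vz] := ltP 0 (dot v z).
  pose s := dot z z / dot v z.
  have s0 : 0 < s by rewrite divr_gt0 // dot_gt0.
  apply: (core (s *: v)) => [y|]; rewrite /petal /= dotZl; last by rewrite divfK // gt_eqF.
  move=> ys; apply: vS; rewrite -(pmulr_rgt0 _ s0).
  by apply: le_lt_trans ys; exact: dot_ge0.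
have {vz kz} vz : dot v z = 0 by apply/eqP; rewrite eq_le vz.
have [[y0 Sy0 vy0]|Sv] := pselect (exists2 y0, S y0 & dot v y0 < 0).
  (* A point u of the petal of z + s v with <v, u> <= <v, y0> would give
   |u - z/2|^2 <= |z|^2/4 + s <v, y0>, which is negative for this s. *)
  pose s := dot z z / - dot v y0.
  have s0 : 0 < s by rewrite divr_gt0 ?dot_gt0 // oppr_gt0.
  have sE : s * dot v y0 = - dot z z.
    by rewrite /s invrN mulrN mulNr divfK // lt_eqF.
  apply: (core (z + s *: v)) => [y|]; rewrite /petal /= dotDl dotZl;
    last by rewrite vz mulr0 addr0.
  move=> ys; apply: convex_half_space_extend cS vS Sy0 _ _.
  rewrite ltNge; apply/negP => vy.
  have h1 : s * dot v y <= s * dot v y0 by rewrite ler_pM2l.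
  have h2 := dot_ge0 (y - 2^-1 *: z); have h3 : 0 < dot z z by rewrite dot_gt0.
  by move: h2; rewrite !dotE (dotC z y) in ys *; lra.
have {}Sv y : S y -> 0 <= dot v y.
  by move=> Sy; rewrite leNgt; apply/negP => vy; apply: Sv; exists y.
exfalso; have [_ [C [_ _ AE]]] := fA.
have Cv := @petal_in_half_space_center C v v0 _.
have {}Cv x : C x -> x = (enorm x / enorm v) *: v.
  by apply: Cv => y Cy; apply: Sv; apply: AS; rewrite AE.
have b0 x : 0 <= enorm x / enorm v by rewrite divr_ge0 ?enorm_ge0.
have vv : 0 < dot v v by rewrite dot_gt0.
have AH : A `<=` half_space_flower v.
  move=> y; rewrite AE => /petals_inP [_ [x Cx]].
  rewrite (Cv _ Cx) /petal /= dotZl => h.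
  have [->|y0] := eqVneq y 0; [by left|right].
  have : 0 < enorm x / enorm v * dot v y by apply: lt_le_trans h; rewrite dot_gt0.
  by move: (b0 x); rewrite le_eqVlt => /orP[/eqP <-|/pmulr_rgt0 -> //]; rewrite mul0r ltxx.
(* A point y of the half-space outside A bounds the generators b v of A. *)
have [HA|] := pselect (half_space_flower v `<=` A).
  by apply: (nA v v0); apply/seteqP.
move=> /existsNP [y /not_implyP [Hy nAy]].
have vy : 0 < dot v y by case: Hy => // yE; case: nAy; rewrite yE; exact: star_set0.
pose b := dot y y / dot v y.
have bp : 0 <= b by rewrite divr_ge0 ?dot_ge0 // ltW.
have : petal (b *: v) z.
  move: Sz; apply: smallest_sub.
    split; first exact: petal_convex.
    apply: closed_le_fun; apply: continuous_dot;
      try exact: cst_continuous; by move=> ?; exact: cvg_id.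
  move=> u Au; have vu := Sv _ (AS _ Au).
  move: Au; rewrite AE => /petals_inP [_ [x Cx]].
  rewrite (Cv _ Cx) /petal /= !dotZl => h; apply: le_trans h _.
  rewrite ler_wpM2r // /b ler_pdivlMr // leNgt; apply/negP => yx.
  apply: nAy; rewrite AE; apply/petals_inP; split; first exact: memvf.
  by exists x => //; rewrite (Cv _ Cx) /petal /= dotZl ltW.
rewrite /petal /= dotZl vz mulr0 leNgt; case/negP.
by rewrite dot_gt0.
Qed.

End ClosedConvexHull.

(** * The theorem *)

Theorem theorem14 (R : realType) (n : nat) (A B : set 'rV[R]_n)
    (E : {vspace 'rV[R]_n}) (hA : flower A) (hB : flower B) :
  [/\ [/\ flower_radial (minkowski_sum A B),
          (star_body (minkowski_sum A B) -> flower (minkowski_sum A B)) &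
          (bounded_set A -> bounded_set B -> flower (minkowski_sum A B))],
      [/\ flower_radial (convex_hull A),
          (star_body (convex_hull A) -> flower (convex_hull A)) &
          ((forall u : 'rV[R]_n, u != 0 -> A <> half_space_flower u) ->
             flower (closed_convex_hull A))],
      flower_in E (A `&` [set` E]) &
      [/\ flower_radial_in E (orth_proj E A),
          (star_body_in E (orth_proj E A) -> flower_in E (orth_proj E A)) &
          (bounded_set A -> flower_in E (orth_proj E A))]].
Proof.
have cA := flower_covered hA; have cB := flower_covered hB.
have [[sA _ _] _] := hA; have [[sB _ _] _] := hB.
have subT (S : set 'rV[R]_n) : S `<=` [set` (fullv : {vspace 'rV[R]_n})].
  by move=> x _; exact: memvf.
have cAB := petal_covered_add cA cB; have sAB := star_set_add sA sB.
have cK := petal_covered_conv cA.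
have sK : star_set (convex_hull A).
  apply: convex_star_set; first exact: convex_hull_convex.
  by apply: sub_gen_smallest; exact: star_set0.
have cP := @petal_covered_proj _ _ E _ cA; have sP := @star_set_proj _ _ E _ sA.
have PE : orth_proj E A `<=` [set` E] by move=> y [].
split.
- split; [exact: covered_flower_radial|exact: covered_flower|move=> bA bB].
  apply: covered_flower => //; apply: closed_star_body => //.
  apply: closed_add; first exact: bounded_flower_compact.
  apply: compact_closed; first exact: norm_hausdorff.
  exact: bounded_flower_compact.
- split; [exact: covered_flower_radial|exact: covered_flower|move=> nA].
  apply: covered_flower; first exact: closed_convex_hull_covered.
  apply: closed_star_body => //; last exact: closed_convex_hull_closed.
  apply: convex_star_set; first exact: closed_convex_hull_convex.
  by apply: sub_gen_smallest; exact: star_set0.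
- apply: covered_flower; first exact: petal_covered_cap.
  by apply: star_body_cap; case: hA.
- split; [exact: covered_flower_radial|exact: covered_flower|move=> bA].
  apply: covered_flower => //; apply: closed_star_body => //.
  by apply: closed_proj; exact: bounded_flower_compact.
Qed.
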